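(* Let $c = 1.000028$. For every positive integer $k$, $$d(k) < k!\left(\frac{2.376\,k\,e^{4ck}}{\log(k+1)}\right)^k,$$ where $d(k) := \max\{\,[\mathbb{Q}_{c(\alpha)}:\mathbb{Q}(\alpha)] \;:\; \alpha \text{ a cyclotomic integer with } l(\alpha)=k\,\}$. In particular, $d(k)$ is finite for all positive integers $k$.
   Context: For a positive integer $n$, $\mathbb{Q}_n$ denotes the extension of $\mathbb{Q}$ generated by a primitive $n$th root of unity in $\mathbb{C}$. A cyclotomic integer is an algebraic integer that can be expressed as a sum of complex roots of unity (repetitions allowed). A representation $\alpha=\sum_{i=1}^k \epsilon_i$ with each $\epsilon_i$ a root of unity has weight $k$. The length $l(\alpha)$ of a cyclotomic integer $\alpha$ is the smallest weight among all representations of $\alpha$ as a sum of roots of unity. The conductor $c(\alpha)$ is the smallest positive integer such that $\mathbb{Q}(\alpha)\subseteq\mathbb{Q}_{c(\alpha)}$ (the function $c(\alpha)$ is not to be confused with the numerical constant $c$). The logarithm is natural. Finiteness of the set of degrees defining $d(k)$ is not assumed a priori; it is part of the assertion. *)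

(* Defs.v *)
(* Roots of unity and their sums are algebraic, so algC stands in for the
   complex numbers. *)
From HB Require Import structures.
From mathcomp Require Import all_boot all_order all_algebra all_field.
From mathcomp Require Import all_classical all_reals all_analysis.

Set Implicit Arguments.
Unset Strict Implicit.
Unset Printing Implicit Defensive.

Import Order.TTheory GRing.Theory Num.Theory.
Local Open Scope classical_set_scope.
Local Open Scope ring_scope.

Definition subfield (S : set algC) : Prop := GRing.divring_closed (mem S).

(* Q(x); every subfield of algC contains the rationals. *)
Definition Qadj (x : algC) : set algC := smallest subfield [set x].

(* Q_n; the field does not depend on the primitive root z. *)
Definition Qcyc (n : nat) : set algC :=
  [set x | exists2 z : algC, n.-primitive_root z & Qadj z x].

(* [E : F] = d for subfields F `<=` E: b is a basis of E over F. *)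
Definition ext_degree (E F : set algC) (d : nat) : Prop :=
  exists b : 'I_d -> algC,
    [/\ forall i, E (b i),
        forall x, E x ->
          exists2 a : 'I_d -> algC, (forall i, F (a i)) &
            x = \sum_(i < d) a i * b i
      & forall a : 'I_d -> algC, (forall i, F (a i)) ->
          \sum_(i < d) a i * b i = 0 -> forall i, a i = 0].

(* 0 < n is needed: every element is a 0.-unity_root. *)
Definition is_root_of_unity (z : algC) : Prop :=
  exists2 n : nat, (0 < n)%N & n.-unity_root z.

Definition has_weight (alpha : algC) (k : nat) : Prop :=
  exists2 eps : 'I_k -> algC, (forall i, is_root_of_unity (eps i)) &
    alpha = \sum_(i < k) eps i.

Definition cyclotomic_integer (alpha : algC) : Prop :=
  alpha \in Aint /\ exists k, has_weight alpha k.

Definition is_least (A : set nat) (n : nat) : Prop := A n /\ lbound A n.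

Definition is_greatest (A : set nat) (n : nat) : Prop := A n /\ ubound A n.

(* The empty sum has weight 0, so 0 has length 0. *)
Definition is_length (alpha : algC) (k : nat) : Prop :=
  is_least [set m | has_weight alpha m] k.

Definition is_conductor (alpha : algC) (n : nat) : Prop :=
  is_least [set m | (0 < m)%N /\ Qadj alpha `<=` Qcyc m] n.

Definition degrees (k : nat) : set nat :=
  [set d | exists alpha : algC, exists n : nat,
     [/\ cyclotomic_integer alpha, is_length alpha k,
         is_conductor alpha n & ext_degree (Qcyc n) (Qadj alpha) d]].

(* Main.v *)
(** Let alpha = eps_1 + ... + eps_k have length k and conductor n, and let P be
the product of the primes up to 2k. An automorphism h fixing alpha gives the
vanishing sum of 2k roots of unity eps_1 + ... + eps_k - h eps_1 - ... - h eps_k.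
By (a form of) Mann's theorem the terms whose quotients are P-th roots of unity
already sum to zero, and minimality of the length forces every class to contain
some eps_i; hence h eps_j is eps_i times a P-th root of unity. If N is the lcm
of the orders of the eps_j then n divides N, so h is determined on Q_n by the
h eps_j, and there are at most (k P)^k such h. Chebyshev's bound P <= 4^(2k)
leaves room to spare. The same class argument shows that 1 + z + ... + z^(k-1)
has length k when z has order k P. *)
Require Import Defs.
From HB Require Import structures.
From mathcomp Require Import all_boot all_order all_algebra all_field.
From mathcomp Require Import all_classical all_reals all_analysis.
From mathcomp Require Import fingroup integral_char zify ring lra.

Set Implicit Arguments.
Unset Strict Implicit.
Unset Printing Implicit Defensive.

Import Order.TTheory GRing.Theory Num.Theory.
Local Open Scope classical_set_scope.
Local Open Scope ring_scope.

(** * Vanishing sums of roots of unity *)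

Lemma sum_exp_root_of_unity (F : fieldType) (x : F) (p : nat) :
  x ^+ p = 1 -> \sum_(l < p) x ^+ l = if x == 1 then p%:R else 0.
Proof.
move=> xp1; case: eqP => [->|/eqP x_neq1].
  by under eq_bigr do rewrite expr1n; rewrite sumr_const card_ord.
have /eqP : (x - 1) * (\sum_(l < p) x ^+ l) = 0 by rewrite -subrX1 xp1 subrr.
by rewrite mulf_eq0 subr_eq0 (negPf x_neq1) /= => /eqP.
Qed.

(** Pigeonhole: if every [p]-th root of unity were a value of [f] on [A], choosing preimages would
    embed ['I_p] into [A]. *)
Lemma exists_unity_root_avoiding (I : finType) (A : pred I) (f : I -> algC)
    (p : nat) :
  (0 < p)%N -> (#|A| < p)%N ->
  exists2 r : algC, r ^+ p = 1 & forall j, A j -> f j != r.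
Proof.
move=> p_gt0 ltAp; have [z prim_z] := C_prim_root_exists p_gt0.
have [/existsP[e /forall_inP Ae]|] :=
    boolP [exists e : 'I_p, [forall (j | A j), f j != z ^+ e]].
  by exists (z ^+ e) => //; rewrite exprAC (prim_expr_order prim_z) expr1n.
rewrite negb_exists => /forallP noe.
have g_ex (e : 'I_p) : exists j, A j && (f j == z ^+ e).
  by have := noe e; rewrite negb_forall_in => /exists_inP[j Aj]; rewrite negbK;
    exists j; apply/andP.
pose g e := xchoose (g_ex e).
have gP e : A (g e) /\ f (g e) = z ^+ e.
  by have /andP[? /eqP] := xchooseP (g_ex e).
have g_inj : injective g.
  move=> d e gde; apply/val_inj/eqP; rewrite /= -(modn_small (ltn_ord d)).
  rewrite -[X in _ == X](modn_small (ltn_ord e)) -(eq_prim_root_expr prim_z).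
  by rewrite -(gP d).2 -(gP e).2 gde.
suff : (p <= #|A|)%N by rewrite leqNgt ltAp.
rewrite -{1}(card_ord p) -(card_codom g_inj).
by apply/subset_leq_card/fintype.subsetP => _ /codomP[e ->]; have [] := gP e.
Qed.

(* The conjugations z |-> z ^ (1 + l M) multiply y_j by the l-th power of the
   p-th root of unity y_j ^ M, so Fourier inversion over l isolates the terms
   with y_j ^ M = 1. When p does not divide M one exponent l is not available;
   the corresponding sum vanishes because some p-th root of unity is not of
   the form y_j ^ M. *)
Lemma sum_prime_class_eq0 (I : finType) (A : pred I) (y : I -> algC)
    (p M : nat) :
  prime p -> (forall j, A j -> y j ^+ (p * M) = 1) ->
  (p %| M)%N || (#|A| < p)%N -> \sum_(j | A j) y j = 0 ->
  \sum_(j | A j && (y j ^+ M == 1)) y j = 0.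
Proof.
move=> p_pr y1 pA sumy; have p_gt0 := prime_gt0 p_pr.
pose S l := \sum_(j | A j) y j ^+ (1 + l * M).
(* [1 + l * M] is always prime to [M], so [p] is the only obstruction to conjugating by this
   exponent. *)
have S0 l : ~~ (p %| 1 + l * M)%N -> S l = 0.
  move=> ndvd; have : coprime (1 + l * M) (p * M).
    rewrite coprime_sym coprimeMl prime_coprime // ndvd /=.
    by rewrite /coprime addnC gcdnMDl gcdn1.
  move=> /Qn_aut_exists[u uE]; rewrite /S.
  under eq_bigr => j Aj do rewrite -uE ?y1 //.
  by rewrite -rmorph_sum sumy rmorph0.
have yM1 j : A j -> (y j ^+ M) ^+ p = 1 by move=> /y1; rewrite -exprM mulnC.
have yS j l r : y j ^+ (1 + l * M) * r ^+ l = y j * (y j ^+ M * r) ^+ l.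
  by rewrite exprD expr1 -mulrA exprMn -exprM [(M * l)%N]mulnC.
have allS (l : 'I_p) : S l = 0.
  have [pl|/S0 //] := boolP (p %| 1 + l * M)%N.
  have npM : ~~ (p %| M)%N.
    apply/negP => pM; move: pl; rewrite dvdn_addl ?dvdn_mull // dvdn1.
    by move/eqP => p1; rewrite p1 in p_pr.
  rewrite (negPf npM) /= in pA.
  have [r r1 rA] := exists_unity_root_avoiding (fun j => y j ^+ M) p_gt0 pA.
  have r_neq0 : r != 0.
    by apply: contra_eq_neq r1 => ->; rewrite expr0n eqn0Ngt p_gt0 eq_sym oner_eq0.
  (* For each [j] this is a geometric sum over the [p]-th root of unity [y j ^+ M / r], which
     differs from 1 by the choice of [r]. Since [l] is the only exponent with [p] dividing
     [1 + l * M], all that remains is [S l] times a nonzero factor. *)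
  have : \sum_(i < p) S i * r^-1 ^+ i = 0.
    under eq_bigr do rewrite mulr_suml.
    rewrite exchange_big big1 //= => j Aj.
    under eq_bigr do rewrite yS.
    rewrite -mulr_sumr sum_exp_root_of_unity; last first.
      by rewrite exprMn yM1 // exprVn r1 invr1 mulr1.
    by rewrite -subr_eq0 -[X in _ - X](divff r_neq0) -mulrBl mulf_eq0 subr_eq0
      invr_eq0 (negPf r_neq0) (negPf (rA _ Aj)) mulr0.
  rewrite (bigD1 l) //= big1 ?addr0 => [/eqP|i ne_il].
    by rewrite mulf_eq0 expf_eq0 invr_eq0 (negPf r_neq0) andbF orbF => /eqP.
  rewrite S0 ?mul0r //; apply: contra ne_il => pi.
  wlog le_li : i l {rA} pl pi / (l <= i)%N.
    by case: (leqP l i) => [|/ltnW] le Hw; [|rewrite eq_sym]; apply: Hw.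
  have : (p %| (i - l) * M)%N.
    by rewrite mulnBl -(subnDl 1%N) dvdn_sub.
  rewrite Euclid_dvdM // (negPf npM) orbF => /dvdn_leq.
  case: (posnP (i - l)) => [il _|il_gt0 /(_ isT)].
    by apply/eqP/val_inj/eqP; rewrite eqn_leq le_li -subn_eq0 il.
  by rewrite leqNgt (leq_ltn_trans (leq_subr _ _)).
have : \sum_(l < p) S l = 0 by rewrite big1.
rewrite exchange_big /=.
have yMl j : A j -> \sum_(l < p) y j ^+ (1 + l * M) =
    (if y j ^+ M == 1 then y j else 0) * p%:R.
  move=> Aj; transitivity (y j * \sum_(l < p) (y j ^+ M) ^+ l).
    by rewrite mulr_sumr; apply: eq_bigr => l _; rewrite exprD -exprM mulnC.
  by rewrite sum_exp_root_of_unity ?yM1 //; case: ifP; rewrite ?mul0r ?mulr0.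
rewrite (eq_bigr _ yMl) -mulr_suml -big_mkcondr /= => /eqP.
by rewrite mulf_eq0 pnatr_eq0 (gtn_eqF p_gt0) orbF => /eqP.
Qed.


(** * Primorials and Mann's theorem *)

Definition primorial (n : nat) : nat := (\prod_(p < n.+1 | prime p) p)%N.

Lemma primorial_gt0 n : (0 < primorial n)%N.
Proof. by apply: prodn_cond_gt0 => p; apply: prime_gt0. Qed.

Lemma prime_dvd_primorial n p : prime p -> (p <= n)%N ->
  exists2 q, primorial n = (p * q)%N & coprime p q.
Proof.
move=> p_pr; rewrite -ltnS => lt_pn; rewrite /primorial.
rewrite (bigD1 (Ordinal lt_pn)) //=; set q := (X in (_ * X)%N).
exists q => //; apply: (big_ind (coprime p)) => [|a b pa pb|i /andP[i_pr ne_ip]].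
- exact: coprimen1.
- by rewrite coprimeMr pa.
- rewrite prime_coprime // dvdn_prime2 // eq_sym; apply: contra ne_ip => /eqP ip; exact/eqP/val_inj.
Qed.

Lemma dvdn_primorial_leq p n : prime p -> (p %| primorial n)%N -> (p <= n)%N.
Proof.
move=> p_pr; rewrite leqNgt; apply: contraTN => lt_np.
rewrite -prime_coprime //; apply: (big_ind (coprime p)) => [|a b pa pb|i i_pr].
- exact: coprimen1.
- by rewrite coprimeMr pa.
- rewrite prime_coprime // dvdn_prime2 //.
  by rewrite gtn_eqF // (leq_trans _ lt_np).
Qed.

(** A primorial is squarefree and contains every prime up to [m], so [N] fails to divide it at a
    prime that exceeds [m] or divides [N] twice. The last clause ensures that replacing [N] by [M]
    loses no term killed by the exponent [primorial m]. *)
Lemma exists_prime_quotient_not_dvd_primorial N m :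
  (0 < N)%N -> ~~ (N %| primorial m)%N ->
  exists p M, [/\ prime p, N = (p * M)%N, (p %| M)%N || (m < p)%N
    & (gcdn (primorial m) N %| M)%N].
Proof.
move=> N_gt0 ndvd; set Q := primorial m.
have [p p_pr /andP[pN bad]] : exists2 p, prime p &
    (p %| N)%N && ((p %| N %/ p)%N || (m < p)%N).
  apply: contrapT => noex; move/negP: ndvd; apply; apply/dvdn_partP => // p.
  rewrite mem_primes => /and3P[p_pr _ pN].
  have /norP[npp] : ~~ ((p %| N %/ p)%N || (m < p)%N).
    by apply/negP => bad; apply: noex; exists p; rewrite ?pN.
  rewrite -leqNgt => /(prime_dvd_primorial p_pr)[q -> _].
  rewrite p_part -(divnK pN) lognM //; [|by rewrite divn_gt0 ?prime_gt0 // dvdn_leq|exact: prime_gt0].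
  by rewrite lognE (negPf npp) !andbF logn_prime // eqxx dvdn_mulr.
have NE : N = (p * (N %/ p))%N by rewrite mulnC divnK.
exists p, (N %/ p)%N; split; rewrite ?bad //.
have [lt_mp|le_pm] := ltnP m p.
  have cop : coprime (gcdn Q N) p.
    rewrite coprime_sym prime_coprime //; apply: contraTN (lt_mp) => pg.
    by rewrite -leqNgt (dvdn_primorial_leq p_pr) // (dvdn_trans pg) ?dvdn_gcdl.
  by rewrite -(Gauss_dvdr _ cop) -NE dvdn_gcdr.
move: bad; rewrite ltnNge le_pm orbF => pM; have [q QE cpq] := prime_dvd_primorial p_pr le_pm.
rewrite /Q QE {1}NE -muln_gcdr Gauss_dvd ?pM ?dvdn_gcdr //.
exact: coprime_dvdr (dvdn_gcdl _ _) cpq.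
Qed.

Lemma expr_gcdn_eq1 (x : algC) a b :
  (0 < a)%N -> x ^+ a = 1 -> x ^+ b = 1 -> x ^+ gcdn a b = 1.
Proof.
move=> a_gt0 xa xb; have [d prim_x _] := prim_order_exists a_gt0 xa.
apply/eqP; rewrite -(prim_order_dvd prim_x) dvdn_gcd.
by rewrite !(prim_order_dvd prim_x) xa xb eqxx.
Qed.

(* Mann's theorem, stated without minimality of the vanishing sum. *)
Lemma sum_primorial_class_eq0 (I : finType) (A : pred I) (y : I -> algC)
    (m N : nat) :
  (0 < N)%N -> (#|A| <= m)%N -> (forall j, A j -> y j ^+ N = 1) ->
  \sum_(j | A j) y j = 0 ->
  \sum_(j | A j && (y j ^+ primorial m == 1)) y j = 0.
Proof.
elim/ltn_ind: N A => N IHN A N_gt0 leA y1 sumy.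
have [/dvdnP[c Qc]|ndvd] := boolP (N %| primorial m)%N.
  rewrite (eq_bigl A) // => j; case Aj: (A j) => //=.
  by rewrite Qc mulnC exprM y1 // expr1n eqxx.
have [p [M [p_pr NE badp dvdM]]] :=
  exists_prime_quotient_not_dvd_primorial N_gt0 ndvd.
have M_gt0 : (0 < M)%N by move: N_gt0; rewrite NE muln_gt0 => /andP[].
have sumM : \sum_(j | A j && (y j ^+ M == 1)) y j = 0.
  apply: (sum_prime_class_eq0 p_pr) => //; first by rewrite -NE.
  by case/orP: badp => [->//|lt_mp]; rewrite (leq_ltn_trans leA) ?orbT.
have ltMN : (M < N)%N by rewrite NE -[X in (X < _)%N]mul1n ltn_pmul2r ?prime_gt1.
have := IHN M ltMN [pred j | A j && (y j ^+ M == 1)] M_gt0.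
move=> IH; rewrite -[RHS]IH //.
- apply: eq_bigl => j /=; case Aj: (A j) => //=.
  have [yQ|] := eqVneq (y j ^+ primorial m) 1; rewrite ?andbF // andbT.
  (* The order of [y j] divides both [primorial m] and [N], hence their gcd, hence [M]. *)
  apply/esym/eqP; have /dvdnP[c ->] := dvdM; rewrite mulnC exprM.
  by rewrite expr_gcdn_eq1 ?expr1n ?primorial_gt0 ?y1.
- apply: leq_trans leA; apply: subset_leq_card.
  by apply/fintype.subsetP => j; rewrite inE => /andP[].
- by move=> j /andP[_ /eqP].
Qed.

(** * Chebyshev bound *)

Lemma primorialS n :
  primorial n.+1 = (primorial n * if prime n.+1 then n.+1 else 1)%N.
Proof. by rewrite /primorial big_mkcond big_ord_recr -big_mkcond. Qed.

Lemma primorial_dvd n Y :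
  (forall p, prime p -> (p <= n)%N -> (p %| Y)%N) -> (primorial n %| Y)%N.
Proof.
elim: n => [|n IHn] pY; first by rewrite /primorial big1 => [|[[|[]]]].
have nY : (primorial n %| Y)%N by apply: IHn => p ? /leqW; apply: pY.
rewrite primorialS; case: ifP => [n_pr|_]; last by rewrite muln1.
rewrite Gauss_dvd ?nY ?pY // coprime_sym prime_coprime //.
by apply/negP => /(dvdn_primorial_leq n_pr); rewrite ltnn.
Qed.

Lemma prime_dvd_fact_leq p n : prime p -> (p %| n`!)%N -> (p <= n)%N.
Proof.
move=> p_pr; elim: n => [|n IHn].
  by rewrite fact0 dvdn1 => /eqP p1; rewrite p1 in p_pr.
by rewrite factS Euclid_dvdM // => /orP[/dvdn_leq->//|/IHn/leqW].
Qed.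

(** The two equal middle coefficients both occur in the expansion of
    [(1 + 1) ^ (2m + 1) = 2 * 4 ^ m]. *)
Lemma bin_odd_middle_leq m : ('C(m.*2.+1, m) <= 4 ^ m)%N.
Proof.
rewrite -(leq_pmul2l (isT : (0 < 2)%N)) [(4 ^ m)%N](_ : _ = 2 ^ m.*2)%N; last first.
  by rewrite -mul2n expnM.
rewrite -expnS -[X in (X ^ _)%N]/(1 + 1)%N expnDn.
have lt_m : (m < m.*2.+2)%N by lia.
have lt_m1 : (m.+1 < m.*2.+2)%N by lia.
rewrite (bigD1 (Ordinal lt_m)) //= (bigD1 (Ordinal lt_m1)) /=; last first.
  by rewrite -val_eqE /= eqn_leq ltnn.
rewrite !exp1n !muln1 addnA mul2n -addnn (_ : 'C(_, m.+1) = 'C(m.*2.+1, m)).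
  exact: leq_addr.
by rewrite -bin_sub; [congr 'C(_, _)|]; lia.
Qed.

(** Erdős's induction: an even number above 2 is not prime, and for [2m + 1] the primes above
    [m + 1] divide ['C(2m + 1, m)], which is at most [4 ^ m]. *)
Lemma primorial_leq n : (primorial n <= 4 ^ n)%N.
Proof.
elim/ltn_ind: n => -[|[|[|n]]] IHn.
- by rewrite /primorial big1 // => -[[]].
- by rewrite /primorial big1 // => -[[|[]]].
- by rewrite !primorialS [primorial 0](_ : _ = 1)%N // /primorial big1 // => -[[]].
have [n_odd|n_even] := boolP (odd n.+3); last first.
  rewrite primorialS [prime _](_ : _ = false) ?muln1.
    exact: leq_trans (IHn _ _) (leq_pexp2l _ _).
  by apply: contraNF n_even => /even_prime[].
have [m nE m_gt0] : exists2 m, n.+3 = m.*2.+1 & (0 < m)%N.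
  by exists (n./2).+1; lia.
rewrite nE (@leq_trans (primorial m.+1 * 'C(m.*2.+1, m)))%N //; last first.
  rewrite (_ : 4 ^ m.*2.+1 = 4 ^ m.+1 * 4 ^ m)%N; last by rewrite -expnD; congr expn; lia.
  by rewrite leq_mul ?bin_odd_middle_leq ?IHn //; lia.
apply: dvdn_leq.
  by rewrite muln_gt0 primorial_gt0 bin_gt0; lia.
apply: primorial_dvd => p p_pr le_p; have [le_pm|lt_mp] := leqP p m.+1.
  by have [q -> _] := prime_dvd_primorial p_pr le_pm; rewrite -mulnA dvdn_mulr.
have : (p %| (m.*2.+1)`!)%N by rewrite dvdn_fact // prime_gt0.
rewrite -(@bin_fact _ m); last by lia.
rewrite !Euclid_dvdM // => /or3P[-> | |]; first by rewrite orbT.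
  by move=> /(prime_dvd_fact_leq p_pr); lia.
by move=> /(prime_dvd_fact_leq p_pr); lia.
Qed.

(** The bases already compare: [32 ^ k <= e ^ (4ck)] splits into [16 ^ k], which bounds the
    primorial, and [2 ^ k], which bounds the logarithm. The factorial is only bounded below by 1. *)
Lemma ltr_card_degree_bound (R : realType) (k : nat) : (0 < k)%N ->
  ((k * primorial k.*2) ^ k)%:R < k`!%:R * (2376 / 1000 * k%:R *
    expR (4 * (1 + 28 / 10 ^+ 6) * k%:R) / ln (k.+1)%:R) ^+ k :> R.
Proof.
move=> k_gt0; have k_gt0' : 0 < k%:R :> R by rewrite ltr0n.
have ln_gt0 : 0 < ln k.+1%:R :> R by rewrite ln_gt0 // ltr1n ltnS.
have ln_le : ln k.+1%:R <= 2 ^+ k :> R.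
  apply: (@le_trans _ _ k%:R); first by rewrite -natr1 addrC le_ln1Dx // (lt_trans _ k_gt0') // ltrN10.
  by rewrite -natrX ler_nat ltnW // ltn_expl.
have exp_ge : (32 : R) ^+ k <= expR (4 * (1 + 28 / 10 ^+ 6) * k%:R).
  apply: (@le_trans _ _ (expR 4 ^+ k)); last first.
    by rewrite -expRM_natr ler_expR ler_pM2r //; lra.
  rewrite lerXn2r ?nnegrE ?expR_ge0 ?ler0n //.
  (* [e ^ 4 >= 32] follows from [e ^ (1/4) >= 5/4] and [(5/4) ^ 16 > 35]. *)
  have -> : 4 = (1 / 4) * 16%:R :> R by lra.
  rewrite expRM_natr; apply: (@le_trans _ _ ((1 + 1 / 4) ^+ 16)); first by lra.
  by rewrite lerXn2r ?nnegrE ?expR_ge0 ?expR_ge1Dx //; lra.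
have P_le : (primorial k.*2)%:R <= 16 ^+ k :> R.
  by rewrite -natrX ler_nat (leq_trans (primorial_leq _)) // -mul2n expnM.
set e := expR _ in exp_ge *; set X := (X in X ^+ k).
have lt_X : (k * primorial k.*2)%:R < X.
  have e_gt0 : 0 < e by apply: expR_gt0.
  rewrite /X ltr_pdivlMr // natrM.
  apply: (@le_lt_trans _ _ (k%:R * e)).
    rewrite -mulrA ler_pM2l // (le_trans _ exp_ge) //.
    apply: (@le_trans _ _ (16 ^+ k * 2 ^+ k)); last by rewrite -exprMn -natrM.
    by rewrite ler_pM ?ler0n // ltW.
  (* The inequality becomes strict here, by the factor 2.376. *)
  by have := mulr_gt0 k_gt0' e_gt0; lra.
have X_ge0 : 0 <= X by rewrite ltW // (le_lt_trans _ lt_X).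
apply: (@lt_le_trans _ _ (X ^+ k)).
  by rewrite natrX ltrXn2r ?nnegrE // -lt0n.
by rewrite ler_peMl ?exprn_ge0 // ler1n fact_gt0.
Qed.

(** * Lengths *)

(** [N] is the lcm of the orders. The forward implication later shows that exponents acting alike on
    all [eps i] agree modulo [N]. *)
Lemma unity_family_order (I : finType) (eps : I -> algC) :
  (forall i, is_root_of_unity (eps i)) ->
  exists2 N, (0 < N)%N & forall m, (forall i, eps i ^+ m = 1) <-> (N %| m)%N.
Proof.
move=> eps1; have /fin_all_exists[d prim_d] i : exists d, d.-primitive_root (eps i).
  have [n n_gt0 /unity_rootP epsn] := eps1 i.
  by have [d ? _] := prim_order_exists n_gt0 epsn; exists d.
exists (\big[lcmn/1%N]_i d i).
  by elim/big_ind: _ => // [a b|i _]; [rewrite lcmn_gt0 => -> ->|apply: prim_order_gt0].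
move=> m; split=> [em|/dvdn_biglcmP em i].
  by apply/dvdn_biglcmP => i _; rewrite (prim_order_dvd (prim_d i)) em.
by apply/eqP; rewrite -(prim_order_dvd (prim_d i)) em.
Qed.

Lemma root_of_unity_neq0 z : is_root_of_unity z -> z != 0.
Proof.
move=> [n n_gt0 /unity_rootP zn]; apply: contra_eq_neq zn => ->.
by rewrite expr0n eqn0Ngt n_gt0 eq_sym oner_eq0.
Qed.

Lemma has_weight_sum (I : finType) (A : {pred I}) (eps : I -> algC) :
  (forall i, is_root_of_unity (eps i)) ->
  has_weight (\sum_(i in A) eps i) #|A|.
Proof.
by move=> eps1; exists (fun i => eps (enum_val i)) => //; rewrite big_enum_val.
Qed.

(** Division by [x i0] moves its class modulo roots of unity of order dividing the primorial to the
    class of 1, where Mann's theorem applies. *)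
Lemma sum_unity_class_eq0 (I : finType) (x : I -> algC) (m : nat) (i0 : I) :
  (forall i, is_root_of_unity (x i)) -> (#|I| <= m)%N -> \sum_i x i = 0 ->
  \sum_(i | (x i / x i0) ^+ primorial m == 1) x i = 0.
Proof.
move=> x1 leI sumx; have [N N_gt0 NP] := unity_family_order x1.
have xN i : x i ^+ N = 1 by apply: (proj2 (NP N) (dvdnn N)).
have x0 := root_of_unity_neq0 (x1 i0).
apply: (mulIf (invr_neq0 x0)); rewrite mul0r mulr_suml.
have := @sum_primorial_class_eq0 I predT (fun i => x i / x i0) m N N_gt0.
apply=> // [j _|]; first by rewrite exprMn exprVn !xN divr1.
by rewrite -mulr_suml sumx mul0r.
Qed.

Lemma dvd2_primorial n : (1 < n)%N -> (2 %| primorial n)%N.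
Proof. by case/(prime_dvd_primorial (isT : prime 2)) => q -> _; rewrite dvdn_mulr. Qed.

(** Otherwise the class of [nu (eps j)] in the vanishing sum consists of conjugates only, and
    pulling it back along [nu] gives a nonempty vanishing subsum of the [eps i]. *)
Lemma conjugate_unity_mod_primorial (k : nat) (eps : 'I_k -> algC)
    (nu : {rmorphism algC -> algC}) (j : 'I_k) :
  (forall i, is_root_of_unity (eps i)) ->
  is_length (\sum_i eps i) k -> nu (\sum_i eps i) = \sum_i eps i ->
  exists i, (nu (eps j) / eps i) ^+ primorial k.*2 = 1.
Proof.
move=> eps1 [_ kmin] nu_fix.
(* An even exponent absorbs the signs of the terms [- nu (eps i)]. *)
have P_even : ~~ odd (primorial k.*2).
  by rewrite -dvdn2 dvd2_primorial //; case: (k) j => [[]|] //.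
pose x (s : 'I_k + 'I_k) := match s with inl i => eps i | inr i => - nu (eps i) end.
have x1 s : is_root_of_unity (x s).
  case: s => i; first exact: eps1.
  have [n n_gt0 /unity_rootP epsn] := eps1 i.
  exists (n * 2)%N; first by rewrite muln_gt0 n_gt0.
  by apply/unity_rootP; rewrite /x mulnC exprM sqrrN -exprM mulnC exprM -rmorphXn epsn rmorph1 expr1n.
have sumx : \sum_s x s = 0.
  by rewrite big_sumType /= sumrN -rmorph_sum nu_fix subrr.
have leI : (#|{: 'I_k + 'I_k}| <= k.*2)%N by rewrite card_sum !card_ord addnn.
have := sum_unity_class_eq0 (inr j) x1 leI sumx.
rewrite big_sumType /=; have [/existsP[i /eqP xi] _|] :=
  boolP [exists i, (x (inl i) / x (inr j)) ^+ primorial k.*2 == 1].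
  exists i; rewrite /= invrN mulrN exprNn -signr_odd (negPf P_even) mul1r in xi.
  by rewrite -[_ / _]invf_div exprVn xi invr1.
rewrite negb_exists => /forallP noi; rewrite [X in X + _]big1 ?add0r; last first.
  by move=> i xi; have := noi i; rewrite xi.
pose J := [pred i | (x (inr i) / x (inr j)) ^+ primorial k.*2 == 1].
rewrite sumrN => /eqP; rewrite oppr_eq0 -rmorph_sum fmorph_eq0 => /eqP sumJ.
have Jj : J j.
  by rewrite /J /= divff ?expr1n // oppr_eq0 fmorph_eq0 root_of_unity_neq0.
(* Dropping the vanishing subsum over [J], which contains [j], leaves a representation of weight
   below [k]. *)
have /kmin : has_weight (\sum_i eps i) #|[predC J]|.
  by rewrite (bigID J) /= [X in X + _]sumJ add0r; apply: has_weight_sum.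
rewrite leEnat -{1}(card_ord k) -(cardC J) -[X in (_ <= X)%N]add0n leq_add2r.
by rewrite leqNgt; case/negP; apply/card_gt0P; exists j.
Qed.

(** Since [z ^+ P] has order [k], the [k] terms lie in distinct classes. In a difference of two
    representations each class sums to zero, so each [z ^+ i] needs a term of the other
    representation in its own class. *)
Lemma is_length_sum_prim_root (k : nat) (z : algC) : (0 < k)%N ->
  (k * primorial k.*2).-primitive_root z ->
  is_length (\sum_(i < k) z ^+ i) k.
Proof.
move=> k_gt0 prim_z; set P := primorial _ in prim_z *.
have P_gt0 : (0 < P)%N := primorial_gt0 _.
have kP_gt0 : (0 < k * P)%N by rewrite muln_gt0 k_gt0.
have P_even : ~~ odd P.
  by rewrite -dvdn2 dvd2_primorial //; case: (k) k_gt0.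
have z1 (i : nat) : is_root_of_unity (z ^+ i).
  by exists (k * P)%N => //; apply/unity_rootP; rewrite exprAC (prim_expr_order prim_z) expr1n.
have zi_inj (i j : 'I_k) : (z ^+ i / z ^+ j) ^+ P = 1 -> i = j.
  have zj0 : z ^+ j ^+ P != 0 by rewrite expf_neq0 // root_of_unity_neq0.
  rewrite exprMn exprVn => /(canRL (mulfVK zj0)) /eqP.
  rewrite mul1r -!exprM (eq_prim_root_expr prim_z) !modn_small ?ltn_mul2r ?P_gt0 ?ltn_ord //.
  by rewrite eqn_pmul2r // => /eqP/val_inj.
split; first by exists (fun i : 'I_k => z ^+ i).
move=> m [del del1 sumE]; rewrite leEnat leqNgt; apply/negP => lt_mk.
pose x (s : 'I_k + 'I_m) := match s with inl i => z ^+ i | inr j => - del j end.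
have x1 s : is_root_of_unity (x s).
  case: s => i; first exact: z1.
  have [n n_gt0 /unity_rootP deln] := del1 i.
  exists (n * 2)%N; first by rewrite muln_gt0 n_gt0.
  by apply/unity_rootP; rewrite /x mulnC exprM sqrrN -exprM mulnC exprM deln expr1n.
have sumx : \sum_s x s = 0 by rewrite big_sumType /= sumrN -sumE subrr.
have leI : (#|{: 'I_k + 'I_m}| <= k.*2)%N.
  by rewrite card_sum !card_ord -addnn leq_add2l ltnW.
have /fin_all_exists[f fP] (i : 'I_k) :
    exists j, (x (inr j) / x (inl i)) ^+ P = 1.
  have := sum_unity_class_eq0 (inl i) x1 leI sumx.
  have [/existsP[j /eqP xj] _|] :=
    boolP [exists j, (x (inr j) / x (inl i)) ^+ P == 1]; first by exists j.
  (* Without such a term the class of [z ^+ i] would be a singleton with sum zero. *)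
  rewrite negb_exists => /forallP noj; rewrite big_sumType /= [X in _ + X]big1.
    rewrite addr0 (big_pred1 i) => [zi0|j].
      by have := root_of_unity_neq0 (z1 i); rewrite zi0 eqxx.
    by apply/eqP/eqP => [/zi_inj|->] //; rewrite divff ?expr1n ?root_of_unity_neq0.
  by move=> j xj; have := noj j; rewrite xj.
have f_inj : injective f.
  move=> i i' eqf; apply: zi_inj.
  have xf0 : x (inr (f i)) != 0 := root_of_unity_neq0 (x1 _).
  have -> : z ^+ i / z ^+ i' =
      (x (inr (f i')) / x (inl i')) / (x (inr (f i)) / x (inl i)).
    by rewrite -eqf invf_div [_ / x (inr _)]mulrC mulrACA divff // mul1r mulrC.
  by rewrite exprMn exprVn !fP invr1 mulr1.
by have := leq_card _ f_inj; rewrite !card_ord leqNgt lt_mk.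
Qed.

(** * Subfields and degrees *)

Section SubfieldClosure.
Variables (S : set algC) (SF : subfield S).

Lemma subfield1 : S 1.
Proof. by have [/set_mem] := SF. Qed.

Lemma subfieldB u v : S u -> S v -> S (u - v).
Proof. by move=> Su Sv; have [_ SB _] := SF; apply/set_mem/SB; apply/mem_set. Qed.

Lemma subfield_div u v : S u -> S v -> S (u / v).
Proof. by move=> Su Sv; have [_ _ SD] := SF; apply/set_mem/SD; apply/mem_set. Qed.

Lemma subfield0 : S 0.
Proof. rewrite -(subrr 1); exact: subfieldB subfield1 subfield1. Qed.

Lemma subfieldN u : S u -> S (- u).
Proof. by rewrite -sub0r; apply: subfieldB subfield0. Qed.

Lemma subfieldD u v : S u -> S v -> S (u + v).
Proof. by move=> Su Sv; rewrite -[v]opprK; apply/subfieldB/subfieldN. Qed.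

Lemma subfieldM u v : S u -> S v -> S (u * v).
Proof.
move=> Su Sv; rewrite -[v]invrK -[v^-1]mul1r.
exact: subfield_div Su (subfield_div subfield1 Sv).
Qed.

Lemma subfield_ratr (q : rat) : S (ratr q).
Proof.
have Snat m : S m%:R.
  elim: m => [|m IHm]; first exact: subfield0.
  by rewrite -natr1; apply: subfieldD IHm subfield1.
have Sint (m : int) : S m%:~R.
  by case: m => m; [exact: Snat|rewrite NegzE mulrNz; apply/subfieldN/Snat].
exact: subfield_div (Sint _) (Sint _).
Qed.

Lemma subfield_horner (p : {poly rat}) (x : algC) :
  S x -> S (map_poly ratr p).[x].
Proof.
move=> Sx; elim/poly_ind: p => [|p c IHp].
  by rewrite rmorph0 horner0; apply: subfield0.
rewrite rmorphD rmorphM /= map_polyX map_polyC /= !hornerE.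
by apply: subfieldD; [apply: subfieldM|apply: subfield_ratr].
Qed.

End SubfieldClosure.

Lemma subfield_Qadj (x : algC) : subfield (Qadj x).
Proof.
split; first by apply/mem_set => A [/subfield1].
- move=> u v /set_mem Su /set_mem Sv; apply/mem_set => A xA.
  by apply: subfieldB; [case: xA|apply: Su|apply: Sv].
- move=> u v /set_mem Su /set_mem Sv; apply/mem_set => A xA.
  by apply: subfield_div; [case: xA|apply: Su|apply: Sv].
Qed.

Lemma Qadj_id (x : algC) : Qadj x x.
Proof. by move=> A [_ xA]; apply: xA. Qed.

Lemma Qadj_sub (x : algC) (S : set algC) : subfield S -> S x -> Qadj x `<=` S.
Proof. by move=> SF Sx y; apply; split=> // _ ->. Qed.

(** * Number fields embedded in [algC] *)

Section NumberFieldImage.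
Variables (L : fieldExtType rat) (f : {rmorphism L -> algC}).

Lemma Fadjoin1_image_horner (x v : L) : v \in <<1; x>>%VS ->
  exists p : {poly rat}, f v = (map_poly ratr p).[f x].
Proof.
move=> /Fadjoin1_polyP[p ->]; exists p; rewrite -horner_map -map_poly_comp.
congr (_ .[_]); apply: eq_map_poly => q; exact: (fmorph_eq_rat (f \o in_alg L)).
Qed.

(** The image of [<<1; x>>] is a subfield containing [f x], and its elements are rational
    polynomials in [f x]. *)
Lemma QadjP (x : L) (y : algC) :
  Qadj (f x) y <-> exists2 v, v \in <<1; x>>%VS & y = f v.
Proof.
split=> [|[v /Fadjoin1_image_horner[p fv] ->]]; last first.
  by rewrite fv; exact: subfield_horner (subfield_Qadj _) _ _ (@Qadj_id _).
apply: (@Qadj_sub _ [set y | exists2 v, v \in <<1; x>>%VS & y = f v]).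
  split; first by apply/mem_set; exists 1; rewrite ?rmorph1 ?mem1v.
  - move=> _ _ /set_mem[u Ku ->] /set_mem[v Kv ->]; apply/mem_set.
    by exists (u - v); rewrite ?rmorphB // rpredB.
  - move=> _ _ /set_mem[u Ku ->] /set_mem[v Kv ->]; apply/mem_set.
    by exists (u / v); rewrite ?fmorph_div // rpred_div.
by exists x => //; apply: memv_adjoin.
Qed.

Lemma eq_rmorph_Fadjoin1 (x v : L) (u1 u2 : {rmorphism algC -> algC}) :
  u1 (f x) = u2 (f x) -> v \in <<1; x>>%VS -> u1 (f v) = u2 (f v).
Proof.
move=> ux /Fadjoin1_image_horner[p ->]; rewrite -!horner_map -!map_poly_comp.
by congr (_ .[_]) => //; apply: eq_map_poly => q /=; rewrite !fmorph_rat.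
Qed.

Lemma dim_fieldOver (K : {subfield L}) :
  \dim {: fieldOver K} = \dim_K {: L}.
Proof.
have <- : vspaceOver K {: L} = fullv.
  apply/vspaceP => v; rewrite memvf mem_aspaceOver; [exact: memvf|exact: subvf].
exact: dim_aspaceOver (subvf K).
Qed.

(** A basis of [L] over [K] is carried over by [f]. Conversely, independence over [F] lifts along
    the injective [f], so any basis of [E] gives a free family in [L]. *)
Lemma ext_degree_image (K : {subfield L}) (E F : set algC) :
  (forall y, E y <-> exists v, y = f v) ->
  (forall y, F y <-> exists2 v, v \in K & y = f v) ->
  ext_degree E F (\dim_K {: L}) /\
  forall d, ext_degree E F d -> (d <= \dim_K {: L})%N.
Proof.
move=> EP FP; rewrite -dim_fieldOver; set M := fieldOver K.
have lift_comb d (a : 'I_d -> algC) (b : 'I_d -> L) :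
    (forall i, F (a i)) -> \sum_(i < d) a i * f (b i) = 0 ->
    exists2 c : 'I_d -> subvs_of K, forall i, a i = f (vsval (c i)) &
      \sum_(i < d) c i *: (b i : M) = 0.
  move=> Fa sum0.
  have /fin_all_exists[c cE] i : exists c : subvs_of K, a i = f (vsval c).
    by have /FP[v Kv ->] := Fa i; exists (vsproj K v); rewrite vsprojK.
  exists c => //; apply: (fmorph_inj f); rewrite rmorph0 -[RHS]sum0 rmorph_sum.
  by apply: eq_bigr => i _; rewrite cE fieldOver_scaleE rmorphM.
split=> [|d [b [Eb _ b_free]]].
  exists (fun i => f (vbasis {: M})`_i); split=> [i|x /EP[v ->]|a Fa sum0 i].
  - by apply/EP; exists (vbasis {: M})`_i.
  - exists (fun i => f (vsval (coord (vbasis {: M}) i v))) => [i|].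
      by apply/FP; exists (vsval (coord (vbasis {: M}) i v)); rewrite ?subvsP.
    rewrite {1}(coord_vbasis (memvf (v : M))) rmorph_sum.
    by apply: eq_bigr => i _; rewrite fieldOver_scaleE rmorphM.
  - have [c cE c0] := lift_comb _ _ _ Fa sum0.
    have /freeP/(_ _ c0)/(_ i) ci := basis_free (vbasisP {: M}).
    by rewrite cE ci rmorph0.
have /fin_all_exists[c cE] i : exists v, b i = f v by apply/EP.
pose X := [tuple (c i : M) | i < d].
suff : free X by move/eqnP; rewrite size_tuple => <-; apply/dimvS/subvf.
apply/freeP => e; under eq_bigr do rewrite nth_mktuple.
move=> sum0 i; apply: subvs_inj; apply: (fmorph_inj f).
rewrite [vsval 0]linear0 rmorph0.
apply: (b_free (fun i => f (vsval (e i)))) => [j|].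
  by apply/FP; exists (vsval (e j)); rewrite ?subvsP.
have := congr1 f sum0; rewrite rmorph0 rmorph_sum => fsum0.
rewrite -[RHS]fsum0.
by apply: eq_bigr => j _; rewrite cE fieldOver_scaleE rmorphM.
Qed.

End NumberFieldImage.

(** * Cyclotomic fields and conductors *)

Lemma cyclotomic_number_field (n : nat) : (0 < n)%N ->
  exists (L : splittingFieldType rat) (f : {rmorphism L -> algC}) (w : L),
    [/\ galois 1 {: L}, n.-primitive_root w, <<1; w>>%VS = fullv &
        forall h, h \in 'Gal({: L} / 1)%g ->
          exists nu : {rmorphism algC -> algC}, {morph f : a / h a >-> nu a}].
Proof.
case: n => // n _.
(* The order of the chosen group prescribes the order of the root of unity [w]. *)
have [L galL [f f_ext [w [prim_w genL] _]]] :=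
  group_num_field_exists [set: 'I_n.+1]%G.
exists L, f, w; split=> //; first by rewrite cardsT card_ord in prim_w.
by move=> h _; have [nu nuE] := f_ext h; exists nu.
Qed.

Lemma fmorph_prim_root_power (L : fieldType) (f : {rmorphism L -> algC})
    (n : nat) (w : L) (z : algC) :
  n.-primitive_root w -> z ^+ n = 1 -> exists i, z = f (w ^+ i).
Proof.
move=> prim_w zn; have prim_fw : n.-primitive_root (f w).
  by rewrite fmorph_primitive_root.
by have [i ->] := prim_rootP prim_fw zn; exists i; rewrite rmorphXn.
Qed.

Lemma QcycP (L : fieldExtType rat) (f : {rmorphism L -> algC}) (n : nat)
    (w : L) (y : algC) : n.-primitive_root w ->
  Qcyc n y <-> exists2 v, v \in <<1; w>>%VS & y = f v.
Proof.
move=> prim_w; split=> [[z prim_z]|yv].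
  have [i ->] := fmorph_prim_root_power f prim_w (prim_expr_order prim_z).
  move=> /QadjP[v vw ->]; exists v => //; apply: subvP vw.
  by apply/FadjoinP; rewrite sub1v rpredX // memv_adjoin.
by exists (f w); [rewrite fmorph_primitive_root | apply/QadjP].
Qed.

(** The Chinese remainder theorem for moduli with a common factor; the congruence modulo the gcd is
    the compatibility condition. *)
Lemma exists_coprime_chinese (n N t : nat) : (0 < N)%N -> coprime t n ->
  t = 1 %[mod gcdn N n] ->
  exists s, [/\ coprime s (n * N), s = t %[mod n] & s = 1 %[mod N]].
Proof.
move=> N_gt0 cop_tn t1.
suff [s [st s1]] : exists s, s = t %[mod n] /\ s = 1 %[mod N].
  exists s; split=> //; rewrite coprimeMr.
  by rewrite -coprime_modl st coprime_modl cop_tn -coprime_modl s1 coprime_modl coprime1n.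
have [u v uv _] := egcdnP n N_gt0; set g := gcdn N n in t1 uv.
have g_gt0 : (0 < g)%N by rewrite gcdn_gt0 N_gt0.
have gn : (g %| n)%N := dvdn_gcdr _ _.
(* [t] can be 0 when [n] is 1; adding [n] keeps the natural subtraction below exact. *)
have tn_gt0 : (0 < t + n)%N.
  by case: (t) cop_tn => // /eqP; rewrite gcd0n => ->.
have /dvdnP[m tnE] : (g %| t + n - 1)%N.
  by rewrite -eqn_mod_dvd // -modnDmr (eqnP gn) addn0 t1.
(* From Bézout's [u * N = v * n + g] and [t + n - 1 = m * g]. *)
exists (1 + m * u * N)%N; split; last by rewrite addnC modnMDl.
rewrite (_ : 1 + m * u * N = m * v * n + (t + n))%N ?modnMDl ?modnDr //.
rewrite -mulnA uv -(subnKC tn_gt0) tnE; ring.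
Qed.


(** An instance of the fact that [Q_N] and [Q_n] meet in [Q_g], [g] their gcd. An automorphism of
    [Q_n] fixing [Q_g] agrees on [Q_n] with one that fixes all [N]-th roots of unity, hence fixes
    the sum; Galois theory concludes. *)
Lemma unity_sum_Qcyc_gcdn (I : finType) (eps : I -> algC) (n N : nat) :
  (0 < n)%N -> (0 < N)%N -> (forall i, eps i ^+ N = 1) ->
  Qcyc n (\sum_i eps i) -> Qcyc (gcdn N n) (\sum_i eps i).
Proof.
move=> n_gt0 N_gt0 epsN; set alpha := \sum_i _.
have [L [f [w [galL prim_w genL h_ext]]]] := cyclotomic_number_field n_gt0.
move=> /(QcycP f _ prim_w)[a _ alphaE]; set g := gcdn N n.
have /dvdnP[q nE] : (g %| n)%N := dvdn_gcdr _ _.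
have q_gt0 : (0 < q)%N by move: n_gt0; rewrite nE muln_gt0 => /andP[].
pose z := w ^+ q.
have prim_z : g.-primitive_root z.
  have := exp_prim_root prim_w q.
  suff -> : (n %/ gcdn q n)%N = g by [].
  by have /gcdn_idPl -> : (q %| n)%N; rewrite nE ?dvdn_mulr // mulKn.
apply/(QcycP f _ prim_z); exists a => //.
have galK : galois <<1; z>> {: L}.
  by apply: galoisS galL; rewrite sub1v subvf.
rewrite -(galois_fixedField galK); apply/fixedFieldP; first exact: memvf.
move=> h Gh; have h1 : h \in 'Gal({: L} / 1)%g.
  by apply: fintype.subsetP Gh; apply: galS; rewrite sub1v.
have [nu nuE] := h_ext h h1.
have hwn : (h w) ^+ n = 1 by rewrite -rmorphXn (prim_expr_order prim_w) rmorph1.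
have [t hw] := prim_rootP prim_w hwn.
have cop_tn : coprime t n.
  have : n.-primitive_root (h w) by rewrite fmorph_primitive_root.
  by rewrite hw prim_root_exp_coprime.
have t1 : t = 1 %[mod g].
  have /eqP : z ^+ t = z ^+ 1.
    rewrite expr1 -[RHS](fixed_gal _ Gh) ?subvf ?memv_adjoin //.
    by rewrite rmorphXn /= hw /z exprAC.
  by rewrite (eq_prim_root_expr prim_z) => /eqP.
have [s [cop_s st s1]] := exists_coprime_chinese N_gt0 cop_tn t1.
have [sigma sigmaE] := Qn_aut_exists cop_s.
have fwn : f w ^+ n = 1 by rewrite -rmorphXn (prim_expr_order prim_w) rmorph1.
have prim_fw : n.-primitive_root (f w) by rewrite fmorph_primitive_root.
apply: (fmorph_inj f); rewrite nuE (@eq_rmorph_Fadjoin1 _ _ w a nu sigma).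
- rewrite -alphaE rmorph_sum; apply: eq_bigr => i _.
  rewrite sigmaE; last by rewrite mulnC exprM epsN expr1n.
  by rewrite -(expr_mod s (epsN i)) s1 expr_mod ?epsN.
- rewrite -nuE hw sigmaE ?exprM ?fwn ?expr1n // rmorphXn.
  by apply/eqP; rewrite (eq_prim_root_expr prim_fw) st.
- by rewrite genL memvf.
Qed.

Lemma ext_degree_Gal (L : splittingFieldType rat) (f : {rmorphism L -> algC})
    (n : nat) (w a : L) :
  galois 1 {: L} -> n.-primitive_root w -> <<1; w>>%VS = fullv ->
  ext_degree (Qcyc n) (Qadj (f a)) #|'Gal({: L} / <<1; a>>)%g| /\
  forall d, ext_degree (Qcyc n) (Qadj (f a)) d ->
    (d <= #|'Gal({: L} / <<1; a>>)%g|)%N.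
Proof.
move=> galL prim_w genL.
have galK : galois <<1; a>> {: L} by apply: galoisS galL; rewrite sub1v subvf.
rewrite -(galois_dim galK); apply: ext_degree_image => y; last exact: QadjP.
split=> [/(QcycP f _ prim_w)[v _ ->]|[v ->]]; first by exists v.
by apply/(QcycP f _ prim_w); exists v; rewrite ?genL ?memvf.
Qed.

Lemma exists_ext_degree (n : nat) (alpha : algC) : (0 < n)%N -> Qcyc n alpha ->
  exists d, ext_degree (Qcyc n) (Qadj alpha) d.
Proof.
move=> /cyclotomic_number_field[L [f [w [galL prim_w genL _]]]].
move=> /(QcycP f _ prim_w)[a _ ->].
by have [? _] := ext_degree_Gal f a galL prim_w genL; eexists; eassumption.
Qed.

(** The sum lies in [Q_g] for [g] the gcd of [N] and [n], so minimality of the conductor forces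
    [g = n]. *)
Lemma conductor_dvd (I : finType) (eps : I -> algC) (n N : nat) :
  (0 < N)%N -> (forall i, eps i ^+ N = 1) ->
  is_conductor (\sum_i eps i) n -> (n %| N)%N.
Proof.
move=> N_gt0 epsN [[n_gt0 sub_n] n_min].
have [z prim_z alpha_z] := unity_sum_Qcyc_gcdn n_gt0 N_gt0 epsN (sub_n _ (@Qadj_id _)).
have /n_min : (0 < gcdn N n)%N /\ Qadj (\sum_i eps i) `<=` Qcyc (gcdn N n).
  split=> [|y alpha_y]; first by rewrite gcdn_gt0 N_gt0.
  by exists z => //; apply: Qadj_sub alpha_y => //; apply: subfield_Qadj.
rewrite leEnat => le_n; apply/gcdn_idPr/eqP.
by rewrite eqn_leq le_n dvdn_leq ?dvdn_gcdr.
Qed.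

(* An element of the stabiliser is determined by the conjugates of the eps_j,
   each of which is some eps_i times a root of unity of order dividing the
   primorial of 2k. *)
Lemma ext_degree_leq (k n d : nat) (eps : 'I_k -> algC) :
  (forall i, is_root_of_unity (eps i)) -> is_length (\sum_i eps i) k ->
  is_conductor (\sum_i eps i) n ->
  ext_degree (Qcyc n) (Qadj (\sum_i eps i)) d ->
  (d <= (k * primorial k.*2) ^ k)%N.
Proof.
move=> eps1 len_k cond_n; have [[n_gt0 sub_n] _] := cond_n.
have [N N_gt0 NP] := unity_family_order eps1.
have epsN : forall i, eps i ^+ N = 1 := proj2 (NP N) (dvdnn N).
have nN := conductor_dvd N_gt0 epsN cond_n.
have [L [f [w [galL prim_w genL h_ext]]]] := cyclotomic_number_field n_gt0.
have /(QcycP f _ prim_w)[a _ alphaE] := sub_n _ (@Qadj_id _).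
rewrite alphaE => /(proj2 (ext_degree_Gal f a galL prim_w genL)) le_d.
apply: leq_trans le_d _; set G := ('Gal(_ / _))%g; set P := primorial _.
have P_gt0 : (0 < P)%N := primorial_gt0 _.
have [zP prim_zP] := C_prim_root_exists P_gt0.
have [zN prim_zN] := C_prim_root_exists N_gt0.
pose code_ok (h : gal_of {: L}) (c : {ffun 'I_k -> 'I_k * 'I_P}) :=
  exists2 nu : {rmorphism algC -> algC}, {morph f : b / h b >-> nu b} &
    forall j, nu (eps j) = eps (c j).1 * zP ^+ (c j).2.
have code_ex h : exists c, h \in G -> code_ok h c.
  have [Gh|_] := boolP (h \in G); last first.
    (* An arbitrary code outside [G]. *)
    by exists [ffun j => (j, Ordinal P_gt0)].
  have h1 : h \in 'Gal({: L} / 1)%g.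
    by apply: fintype.subsetP Gh; apply: galS; rewrite sub1v.
  have [nu nuE] := h_ext h h1.
  have nu_fix : nu (\sum_i eps i) = \sum_i eps i.
    by rewrite alphaE -nuE (fixed_gal _ Gh) ?subvf ?memv_adjoin.
  have /fin_all_exists[c cE] j : exists c : 'I_k * 'I_P,
      nu (eps j) = eps c.1 * zP ^+ c.2.
    have [i nuP] := conjugate_unity_mod_primorial j eps1 len_k nu_fix.
    have [e eE] := prim_rootP prim_zP nuP; exists (i, e) => /=.
    by rewrite -eE mulrC divfK ?root_of_unity_neq0.
  by exists (finfun c) => _; exists nu => // j; rewrite ffunE cE.
have [code codeP] := fin_all_exists code_ex.
have code_inj : {in G &, injective code}.
  move=> h1 h2 /codeP[nu1 nu1E c1] /codeP[nu2 nu2E c2] eq_c.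
  (* Every automorphism acts on the [N]-th roots of unity as a single power map. *)
  have nu_pow (nu : {rmorphism algC -> algC}) :
      exists s, forall x, x ^+ N = 1 -> nu x = x ^+ s.
    have [|s sE] := prim_rootP prim_zN (_ : nu zN ^+ N = 1).
      by rewrite -rmorphXn (prim_expr_order prim_zN) rmorph1.
    exists s => x /(prim_rootP prim_zN)[i ->].
    by rewrite rmorphXn /= sE exprAC.
  have [s1 s1E] := nu_pow nu1; have [s2 s2E] := nu_pow nu2.
  have fwN : f w ^+ N = 1.
    have /dvdnP[m ->] := nN.
    by rewrite mulnC exprM -rmorphXn (prim_expr_order prim_w) rmorph1 expr1n.
  have eq_nu : nu1 (f w) = nu2 (f w).
    rewrite s1E // s2E //.
    (* Modulo [N] this is [s1 - s2], written without subtraction; it kills every [eps j] because the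
       codes agree. *)
    have : (N %| s1 + N.-1 * s2)%N.
      apply/NP => j; rewrite exprD -s1E // c1 eq_c -c2 s2E // -exprD.
      by rewrite -mulSn prednK // exprM epsN expr1n.
    case/dvdnP => m sE; apply: (mulIf (expf_neq0 (N.-1 * s2) (_ : f w != 0))).
      by apply: root_of_unity_neq0; exists N => //; apply/unity_rootP.
    by rewrite -!exprD sE -mulSn prednK // mulnC !exprM fwN !expr1n.
  apply/eqP/gal_eqP => b _; apply: (fmorph_inj f); rewrite nu1E nu2E.
  by apply: (eq_rmorph_Fadjoin1 eq_nu); rewrite genL memvf.
rewrite -(card_in_imset code_inj); apply: leq_trans (max_card _) _.
by rewrite card_ffun card_prod !card_ord.
Qed.

(** * Attained degrees *)

Lemma exists_is_least (A : set nat) (m : nat) : A m -> exists n, is_least A n.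
Proof.
move=> Am; have exA : exists n, `[< A n >] by exists m; apply/asboolP.
have [n /asboolP An n_min] := ex_minnP exA.
by exists n; split=> // i Ai; apply/n_min/asboolP.
Qed.

Lemma exists_is_greatest (A : set nat) (m b : nat) :
  A m -> (forall n, A n -> (n <= b)%N) -> exists n, is_greatest A n.
Proof.
move=> Am leb; have exA : exists n, `[< A n >] by exists m; apply/asboolP.
have leb' n : `[< A n >] -> (n <= b)%N by move=> /asboolP/leb.
have [n /asboolP An n_max] := ex_maxnP exA leb'.
by exists n; split=> // i Ai; apply/n_max/asboolP.
Qed.

(** A maximum requires an attained degree; the sum of the first [k] powers of a root of unity of
    order [N] supplies one. *)
Lemma degrees_nonempty (k : nat) : (0 < k)%N -> exists d, degrees k d.
Proof.
move=> k_gt0; pose N := (k * primorial k.*2)%N.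
have N_gt0 : (0 < N)%N by rewrite muln_gt0 k_gt0 primorial_gt0.
have [z prim_z] := C_prim_root_exists N_gt0.
have len_k := is_length_sum_prim_root k_gt0 prim_z.
set alpha := \sum_(i < k) _ in len_k.
have Qz := subfield_Qadj z.
have alpha_z : Qadj z alpha.
  apply: (big_ind (Qadj z)) => [|u v|i _]; [exact: subfield0|exact: subfieldD|].
  elim: (nat_of_ord i) => [|m IHm]; first exact: subfield1.
  by rewrite exprS; apply: subfieldM IHm => //; apply: Qadj_id.
have [n cond_n] : exists n, is_conductor alpha n.
  apply: (@exists_is_least _ N); split=> // y alpha_y.
  by exists z => //; apply: Qadj_sub alpha_y.
have [d d_n] : exists d, ext_degree (Qcyc n) (Qadj alpha) d.
  by have [[n_gt0 sub_n] _] := cond_n; exact: exists_ext_degree n_gt0 (sub_n _ (@Qadj_id _)).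
exists d, alpha, n; split=> //; split; last by exists k; have [] := len_k.
apply: rpred_sum => i _; apply/rpredX/(Aint_unity_root N_gt0)/unity_rootP.
exact: prim_expr_order.
Qed.

Theorem mainTheorem1 (R : realType) (k : nat) (k_gt0 : (0 < k)%N) :
  let c : R := 1 + 28 / 10 ^+ 6 in
  exists d : nat, is_greatest (degrees k) d /\
    d%:R < k`!%:R *
      (2376 / 1000 * k%:R * expR (4 * c * k%:R) / ln (k.+1)%:R) ^+ k.
Proof.
move=> c; have degrees_leq d : degrees k d -> (d <= (k * primorial k.*2) ^ k)%N.
  move=> [alpha [n [_ len_k cond_n]]]; have [[eps eps1 alphaE] _] := len_k.
  by rewrite alphaE in len_k cond_n *; apply: ext_degree_leq eps1 len_k cond_n.
have [m km] := degrees_nonempty k_gt0.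
have [d d_max] := exists_is_greatest km degrees_leq; exists d; split=> //.
apply: le_lt_trans (ltr_card_degree_bound R k_gt0).
by rewrite ler_nat; apply: degrees_leq; case: d_max.
Qed.
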